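(* In the general ordered alphabet model, let $w$ be a word with $|w|=n$, $\mathrm{alph}(w)=\Sigma$ and universality index $\iota(w)$, and let $k$ be an integer with $n\ge k$. Computing the minimal number of insertions (respectively, deletions, or substitutions) needed to transform $w$ into a $k$-universal word (with respect to $\mathrm{alph}(w)$) requires $\Omega(n\log n)$ comparisons (and hence $\Omega(n\log n)$ time).
   Context: General ordered alphabet model: the input is a sequence of elements of a totally ordered set $\mathcal U$; an algorithm may use the operations of the word RAM, but cannot access or store input elements directly — it may only compare two input elements with respect to the order of $\mathcal U$, each comparison costing $O(1)$ time. A word $v=v_1\cdots v_\ell$ is a subsequence of $w$ if $w=x_1v_1\cdots x_\ell v_\ell x_{\ell+1}$ for some words $x_i$; $w$ is $k$-universal w.r.t. $\Sigma$ if every word of length $k$ over $\Sigma$ is a subsequence of $w$, and $\iota(w)$ is the largest such $k$ for $\Sigma=\mathrm{alph}(w)$. Insertions, deletions and substitutions are the single-letter edit operations. *)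

(* Defs.v *)
From mathcomp Require Import all_boot all_order all_algebra.
From mathcomp Require Import classical_sets cardinality reals exp.

Set Implicit Arguments.
Unset Strict Implicit.
Unset Printing Implicit Defensive.

Section Words.
Variable U : eqType.
Implicit Types u v w : seq U.

(* The alphabet is given by a word s, standing for alph(s). *)
Definition k_universal (k : nat) (s w : seq U) : Prop :=
  forall v, size v = k -> {subset v <= s} -> subseq v w.

Inductive edit_op := Insertion | Deletion | Substitution.

Definition edit (op : edit_op) u v : Prop :=
  match op with
  | Insertion => exists x y a, u = x ++ y /\ v = x ++ a :: y
  | Deletion => exists x y a, u = x ++ a :: y /\ v = x ++ y
  | Substitution => exists x y a c, u = x ++ a :: y /\ v = x ++ c :: y
  end.

Fixpoint edits (op : edit_op) (m : nat) u v : Prop :=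
  if m is m'.+1 then exists2 u', edit op u u' & edits op m' u' v else u = v.

Definition reaches_universal (op : edit_op) (k : nat) w (m : nat) : Prop :=
  exists2 w', edits op m w w' & k_universal k w w'.

(* None is the answer "impossible" (minimum over the empty set): e.g. no number
   of deletions makes w k-universal if it is not k-universal already. *)
Definition is_min_edits (op : edit_op) (k : nat) w (res : option nat) : Prop :=
  match res with
  | Some m => reaches_universal op k w m /\
              forall m', reaches_universal op k w m' -> m <= m'
  | None => forall m, ~ reaches_universal op k w m
  end.

End Words.

(* Word RAM in the general ordered alphabet model.  Words are the naturals
   below 2 ^ b.  The input word is not stored in the registers or the memory:
   it is visible only through the instruction Compare, which takes two input
   positions. *)

Inductive binop := Add | Sub | Mul | Div | Mod | And | Or | Xor | Shl | Shr.

Definition eval_binop (b : nat) (o : binop) (x y : nat) : nat :=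
  (match o with
   | Add => x + y
   | Sub => x + (2 ^ b - y)
   | Mul => x * y
   | Div => x %/ y
   | Mod => x %% y
   | And => Nat.land x y
   | Or => Nat.lor x y
   | Xor => Nat.lxor x y
   | Shl => x * 2 ^ y
   | Shr => x %/ 2 ^ y
   end) %% 2 ^ b.

(* r, s, t, i, j, hi, lo are register names and l is a program address. *)
Inductive instr :=
| Const (r c : nat)             (* r := c mod 2 ^ b *)
| Op (o : binop) (r s t : nat)  (* r := s o t *)
| MemRead (r s : nat)           (* r := memory[s] *)
| MemWrite (r s : nat)          (* memory[r] := s *)
| JumpEq (r s l : nat)          (* if r = s then goto l *)
| JumpLt (r s l : nat)          (* if r < s then goto l *)
| Compare (r i j : nat)         (* r := outcome for input positions i and j *)
| Return (hi lo : nat)          (* output hi * 2 ^ b + lo *)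
| ReturnImpossible.

Definition program := seq instr.

Record config := Config {
  counter : nat;
  register : nat -> nat;
  memory : nat -> nat
}.

Definition update (f : nat -> nat) (a x : nat) : nat -> nat :=
  fun c => if c == a then x else f c.

Inductive outcome :=
| Next (compared : bool) (c : config)
| Halt (res : option nat)
| Crash.

Definition step (b : nat) (P : program) (cmp : nat -> nat -> option nat)
    (c : config) : outcome :=
  let: Config p R M := c in
  match onth P p with
  | None => Crash
  | Some ins =>
    match ins with
    | Const r x => Next false (Config p.+1 (update R r (x %% 2 ^ b)) M)
    | Op o r s t =>
        Next false (Config p.+1 (update R r (eval_binop b o (R s) (R t))) M)
    | MemRead r s => Next false (Config p.+1 (update R r (M (R s))) M)
    | MemWrite r s => Next false (Config p.+1 R (update M (R r) (R s)))
    | JumpEq r s l => Next false (Config (if R r == R s then l else p.+1) R M)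
    | JumpLt r s l => Next false (Config (if R r < R s then l else p.+1) R M)
    | Compare r i j =>
        if cmp (R i) (R j) is Some x
        then Next true (Config p.+1 (update R r (x %% 2 ^ b)) M)
        else Crash
    | Return hi lo => Halt (Some (R hi * 2 ^ b + R lo))
    | ReturnImpossible => Halt None
    end
  end.

(* runs b P cmp c res t q: from c the machine halts with output res after t
   steps, q of which are comparisons of input elements. *)
Inductive runs (b : nat) (P : program) (cmp : nat -> nat -> option nat) :
    config -> option nat -> nat -> nat -> Prop :=
| RunsHalt c res : step b P cmp c = Halt res -> runs b P cmp c res 1 0
| RunsNext c (compared : bool) c' res t q :
    step b P cmp c = Next compared c' -> runs b P cmp c' res t q ->
    runs b P cmp c res t.+1 (compared + q).

Definition init_config (n k : nat) : config :=
  Config 0 (fun r => if r == 0 then n else if r == 1 then k else 0)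
    (fun=> 0).

Section Algorithms.
Variables (d : Order.disp_t) (U : orderType d).

(* The three outcomes 0, 1, 2 mean <, =, >; positions start from 0 and a
   position outside w gives None. *)
Definition compare_positions (w : seq U) (i j : nat) : option nat :=
  match onth w i, onth w j with
  | Some x, Some y =>
      Some (if (x < y)%O then 0 else if x == y then 1 else 2)
  | _, _ => None
  end.

Definition runs_on (b : nat -> nat) (P : program) (k : nat) (w : seq U) :
    option nat -> nat -> nat -> Prop :=
  runs (b (size w)) P (compare_positions w) (init_config (size w) k).

(* The word size is at least logarithmic in the input length. *)
Definition valid_word_size (b : nat -> nat) : Prop := forall n, n < 2 ^ b n.

Definition computes_min_edits (op : edit_op) (b : nat -> nat) (P : program) :
    Prop :=
  forall (w : seq U) (k : nat), k <= size w ->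
    exists res t q, runs_on b P k w res t q /\ is_min_edits op k w res.

Definition uses_comparisons (b : nat -> nat) (P : program) (k : nat)
  (w : seq U) (q : nat) : Prop := exists res t, runs_on b P k w res t q.

Definition uses_time (b : nat -> nat) (P : program) (k : nat)
  (w : seq U) (t : nat) : Prop := exists res q, runs_on b P k w res t q.

(* The maximum of cost over the inputs (w, k) with k <= |w| = n is Omega(f n). *)
Definition worst_case_Omega (R : realType)
    (cost : nat -> seq U -> nat -> Prop) (f : nat -> R) : Prop :=
  exists2 c : R, (0 < c)%R &
    exists n0 : nat, forall n, n0 <= n ->
      exists (w : seq U) (k m : nat),
        [/\ size w = n, k <= n, cost k w m & (c * f n <= m%:R)%R].

End Algorithms.

(* Main.v *)
(**
  A word is [k]-universal exactly when the minimal number of edits is [0], for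
  all three kinds of edits, so it suffices to bound the cost of recognising
  [2]-universal words.  Consider the words [x ++ y] where [x] is fixed and
  contains every letter and [y] is an arbitrary permutation of the [m ~ n / 2]
  letters; all of them are [2]-universal.  If the machine never compares the
  [j]-th letter of [y] with an equal letter of [x], then replacing it by a fresh
  letter just above it changes no outcome, although the fresh letter occurs only
  once and so destroys [2]-universality.  Hence the outcomes of the comparisons
  determine the permutation, and [m! <= 3 ^ q] for the maximal number [q] of
  comparisons.
*)
Require Import Defs.
From mathcomp Require Import all_boot all_order all_algebra.
From mathcomp Require Import classical_sets cardinality reals exp.
From mathcomp Require Import boolp perm zify lra.

Set Implicit Arguments.
Unset Strict Implicit.
Unset Printing Implicit Defensive.

Import Order.TTheory GRing.Theory Num.Theory.

(** * Runs of the machine as sequences of comparisons *)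

Section Traces.
Variables (b : nat) (P : program).
Implicit Types (cmp : nat -> nat -> option nat) (c : config).
Implicit Types (L : seq (nat * nat * nat)).

Definition query c : option (nat * nat) :=
  if onth P (counter c) is Some (Compare _ i j)
  then Some (register c i, register c j) else None.

(* An entry (i, j, x) of a trace is a comparison of positions i and j with
   outcome x. *)
Inductive trace cmp : config -> option nat -> seq (nat * nat * nat) -> Prop :=
| TraceHalt c res :
    query c = None -> step b P cmp c = Halt res -> trace cmp c res [::]
| TraceStep c c' res L :
    query c = None -> step b P cmp c = Next false c' -> trace cmp c' res L ->
    trace cmp c res L
| TraceCompare c c' i j x res L :
    query c = Some (i, j) -> cmp i j = Some x ->
    step b P cmp c = Next true c' -> trace cmp c' res L ->
    trace cmp c res ((i, j, x) :: L).

Lemma step_query_none cmp cmp' c :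
  query c = None -> step b P cmp c = step b P cmp' c.
Proof. by case: c => p R M; rewrite /query /step /=; case: onth => // -[]. Qed.

Lemma step_query_some cmp cmp' c i j :
  query c = Some (i, j) -> cmp i j = cmp' i j ->
  step b P cmp c = step b P cmp' c.
Proof.
case: c => p R M; rewrite /query /step /=.
by case: onth => // -[] // r i' j' [<- <-] ->.
Qed.

Lemma runs_leq cmp c res t q : runs b P cmp c res t q -> q <= t.
Proof. by elim=> // {}c compared c' {}res {}t {}q _ _; case: compared; lia. Qed.

Lemma trace_of_runs cmp c res t q :
  runs b P cmp c res t q -> exists2 L, trace cmp c res L & size L = q.
Proof.
elim=> {c res t q} [c res H|c compared c' res t q H _ [L trL <-]].
  exists [::] => //; apply: TraceHalt => //.
  case: c H => p R M; rewrite /query /step /=.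
  by case: onth => // -[] // r i j; case: (cmp _ _).
case Eq: (query c) => [[i j]|]; last first.
  have E : compared = false.
    by case: c H Eq => p R M; rewrite /query /step /=;
      case: onth => // -[] //= *; congruence.
  by rewrite E in H *; exists L => //; apply: TraceStep H trL.
have [x Ex E] : exists2 x, cmp i j = Some x & compared = true.
  case: c H Eq => p R M; rewrite /query /step /=.
  case: onth => // -[] // r i' j'; case Ec: (cmp _ _) => [x|] // [<- _] [<- <-].
  by exists x.
by rewrite E in H *; exists ((i, j, x) :: L) => //; apply: TraceCompare H trL.
Qed.

Lemma trace_sound cmp c res L i j x :
  trace cmp c res L -> (i, j, x) \in L -> cmp i j = Some x.
Proof.
elim=> // {}c c' i' j' x' {}res {}L _ Hc _ _ IH.
by rewrite inE => /orP[/eqP[-> -> ->]|/IH].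
Qed.

(** The input influences a run only through comparison outcomes, so a run whose recorded outcomes
    remain valid under [cmp'] is followed step by step. *)
Lemma trace_agree cmp cmp' c res res' L L' :
  trace cmp c res L -> trace cmp' c res' L' ->
  (forall i j x, (i, j, x) \in L -> cmp' i j = Some x) -> res = res'.
Proof.
move=> tr; elim: tr res' L' => {c res L}
  [c res Q S|c c' res L Q S _ IH|c c' i j x res L Q C S _ IH] res' L' tr' A;
  case: tr' Q S A => {L' res'}
  [d r Q' S'|d d' r L' Q' S' T|d d' i' j' x' r L' Q' C' S' T] Q S A.
- by move: S; rewrite (step_query_none _ cmp') // S' => -[].
- by move: S; rewrite (step_query_none _ cmp') // S'.
- by rewrite Q in Q'.
- by move: S; rewrite (step_query_none _ cmp') // S'.
- move: S; rewrite (step_query_none _ cmp') // S' => -[E].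
  by rewrite E in T; apply: IH T A.
- by rewrite Q in Q'.
- by rewrite Q in Q'.
- by rewrite Q in Q'.
move: S; rewrite (step_query_some (cmp' := cmp') Q); last first.
  by rewrite C (A i j x) ?mem_head.
rewrite S' => -[E]; rewrite E in T; apply: IH T _ => k l y kl.
by apply: A; rewrite inE kl orbT.
Qed.

(* The paddings z and z' are harmless, as the outcome sequences of halting runs
   from a common configuration form a prefix code. *)
Lemma trace_answers_inj cmp cmp' c res res' L L' (z z' : seq nat) :
  trace cmp c res L -> trace cmp' c res' L' ->
  [seq e.2 | e <- L] ++ z = [seq e.2 | e <- L'] ++ z' -> L = L'.
Proof.
move=> tr; elim: tr res' L' => {c res L}
  [c res Q S|c c' res L Q S _ IH|c c' i j x res L Q C S _ IH] res' L' tr' A;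
  case: tr' Q S A => {L' res'}
  [d r Q' S'|d d' r L' Q' S' T|d d' i' j' x' r L' Q' C' S' T] Q S A //.
- by move: S; rewrite (step_query_none _ cmp') // S'.
- by rewrite Q in Q'.
- by move: S; rewrite (step_query_none _ cmp') // S'.
- move: S; rewrite (step_query_none _ cmp') // S' => -[E].
  by rewrite E in T; apply: IH T A.
- by rewrite Q in Q'.
- by rewrite Q in Q'.
- by rewrite Q in Q'.
(* The positions queried depend on the configuration alone, so equal outcomes lead to equal entries
   and to a common next configuration. *)
move: A => /= -[Ex A]; move: Q'; rewrite Q => -[Ei Ej]; subst i' j' x'.
move: S; rewrite (step_query_some (cmp' := cmp') Q) ?C ?C' //.
by rewrite S' => -[E]; rewrite E in T; rewrite (IH _ _ T A).
Qed.

End Traces.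

(** * Universality of words and outcomes of comparisons *)

Lemma is_min_edits_universal (U : eqType) op k (w : seq U) res :
  is_min_edits op k w res -> k_universal k w w -> res = Some 0.
Proof.
move=> H ku; have r0 : reaches_universal op k w 0 by exists w.
by case: res H => [[|m] [_ /(_ 0 r0)]|/(_ 0)].
Qed.

Lemma is_min_edits0 (U : eqType) op k (w : seq U) :
  is_min_edits op k w (Some 0) -> k_universal k w w.
Proof. by case=> -[w' /= <-]. Qed.

Lemma cat_2universal (U : eqType) (s x y : seq U) :
  {subset s <= x} -> {subset s <= y} -> k_universal 2 s (x ++ y).
Proof.
move=> sx sy [|a1 [|a2 []]] // _ sub.
by apply: (@cat_subseq _ [:: a1] [:: a2]); rewrite sub1seq;
  [apply: sx|apply: sy]; apply: sub; rewrite !inE eqxx ?orbT.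
Qed.

(** The word [[:: a; a]] would need two occurrences of [a]. *)
Lemma single_letter_not_2universal (U : eqType) a (x y : seq U) :
  a \notin x -> a \notin y -> ~ k_universal 2 (x ++ a :: y) (x ++ a :: y).
Proof.
move=> ax ay /(_ [:: a; a] erefl) sub.
have /sub/(leq_count_subseq (pred1 a)) : {subset [:: a; a] <= x ++ a :: y}.
  by move=> c; rewrite !inE orbb => /eqP->; rewrite mem_cat mem_head orbT.
by rewrite count_cat /= eqxx !(count_memPn _).
Qed.

Lemma compare_positions_lt3 (d : Order.disp_t) (U : orderType d) (w : seq U) i j
    x : compare_positions w i j = Some x -> x < 3.
Proof.
rewrite /compare_positions; case: onth => // a; case: onth => // c [<-].
by case: ifP => // _; case: ifP.
Qed.

(** Outcomes depend only on relative order, so words over [U] may be studied through words of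
    natural numbers. *)
Lemma compare_positions_map (d d' : Order.disp_t) (T : orderType d)
    (U : orderType d') (e : T -> U) (s : seq T) i j :
  {in s &, {mono e : x y / (x < y)%O}} ->
  compare_positions (map e s) i j = compare_positions s i j.
Proof.
move=> em; rewrite /compare_positions !onth_map.
case Ei: (onth s i) => [x|] //=; case Ej: (onth s j) => [y|] //=.
have xs : x \in s by apply/onthP; exists i.
have ys : y \in s by apply/onthP; exists j.
have := em _ _ xs ys; have := em _ _ ys xs.
by case: (ltgtP x y) => [||->]; rewrite ?ltxx ?eqxx //; case: (ltgtP (e x) (e y)).
Qed.

Lemma onth_cat_cons_neq (T : Type) (s1 s2 : seq T) z z' i : i != size s1 ->
  onth (s1 ++ z :: s2) i = onth (s1 ++ z' :: s2) i.
Proof.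
rewrite !onth_cat; case: ltngtP => // lt_i _.
by rewrite -[i - size s1]prednK ?subn_gt0.
Qed.

Lemma onth_cat_cons_eq (T : Type) (s1 s2 : seq T) z :
  onth (s1 ++ z :: s2) (size s1) = Some z.
Proof. by rewrite onth_cat ltnn subnn. Qed.

(** An even [y] other than the even [z] lies on the same side of [z] and of [z.+1]; hence only
    comparisons with another copy of [z] can notice the change. *)
Lemma compare_positions_bump (s1 s2 : seq nat) z i j :
    all (fun x => ~~ odd x) (s1 ++ z :: s2) ->
    ~ (exists2 q, q != size s1 & onth (s1 ++ z :: s2) q = Some z /\
        ((i, j) = (size s1, q) \/ (i, j) = (q, size s1))) ->
  compare_positions (s1 ++ z :: s2) i j =
  compare_positions (s1 ++ z.+1 :: s2) i j.
Proof.
move=> ev nq; rewrite /compare_positions.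
have zev : ~~ odd z.
  by apply: (allP ev); apply/onthP; exists (size s1); exact: onth_cat_cons_eq.
have [Ei|ni] := eqVneq i (size s1); have [Ej|nj] := eqVneq j (size s1).
- by rewrite Ei Ej !onth_cat_cons_eq !ltxx !eqxx.
- rewrite Ei !onth_cat_cons_eq -(onth_cat_cons_neq s2 z z.+1 nj).
  case Ey: onth => [y|] //.
  have yev : ~~ odd y by apply: (allP ev); apply/onthP; exists j.
  have yz : y <> z.
    by move=> yz; apply: nq; exists j; rewrite // Ey yz; split=> //; left; rewrite Ei.
  congr Some; rewrite !ltEnat /=.
  by case: (ltngtP z y); case: (ltngtP z.+1 y) => //; lia.
- rewrite Ej !onth_cat_cons_eq -(onth_cat_cons_neq s2 z z.+1 ni).
  case Ey: onth => [y|] //.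
  have yev : ~~ odd y by apply: (allP ev); apply/onthP; exists i.
  have yz : y <> z.
    by move=> yz; apply: nq; exists i; rewrite // Ey yz; split=> //; right; rewrite Ej.
  congr Some; rewrite !ltEnat /=.
  by case: (ltngtP y z); case: (ltngtP y z.+1) => //; lia.
by rewrite !(onth_cat_cons_neq s2 z z.+1).
Qed.

(** * Hard words built from permutations *)

Section HardWords.
Variables (d : Order.disp_t) (U : orderType d).
Variables (op : edit_op) (b : nat -> nat) (P : program).
Hypothesis P_correct : computes_min_edits U op b P.
Variables (m n : nat) (e : nat -> U).
Hypothesis e_mono : {in gtn m.*2 &, {mono e : x y / x < y >-> (x < y)%O}}.
Hypothesis m_gt0 : 0 < m.
Hypothesis m_le : m.*2 <= n.

Notation trace_on w := (trace (b (size w)) P (compare_positions w)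
  (init_config (size w) 2)).

Lemma letters_inj : {in gtn m.*2 &, injective e}.
Proof.
move=> x y xm ym E; move: (e_mono xm ym) (e_mono ym xm); rewrite E ltxx.
by case: ltngtP.
Qed.

(** Adversary argument: otherwise replacing [z] by [z.+1] would preserve the trace and hence the
    answer [Some 0], although the new word is not 2-universal. *)
Lemma trace_sees_equal (s1 s2 : seq nat) z L :
    all (fun x => ~~ odd x && (x < m.*2)) (s1 ++ z :: s2) ->
    1 < size (s1 ++ z :: s2) ->
    trace_on (map e (s1 ++ z :: s2)) (Some 0) L ->
  exists2 q, q != size s1 & onth (s1 ++ z :: s2) q = Some z /\
    ((size s1, q, 1) \in L \/ (q, size s1, 1) \in L).
Proof.
set s := s1 ++ z :: s2; set s' := s1 ++ z.+1 :: s2 => ev s_gt1 trL.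
have sm x : x \in s -> x < m.*2 by move=> /(allP ev)/andP[].
have sev x : x \in s -> ~~ odd x by move=> /(allP ev)/andP[].
have zs : z \in s by rewrite mem_cat mem_head orbT.
(* Both [z] and [m.*2] are even, so the fresh letter stays in the range where [e] is monotone. *)
have zm : z.+1 < m.*2 by have := sm _ zs; have := sev _ zs; lia.
have s'm x : x \in s' -> x < m.*2.
  rewrite mem_cat inE orbCA => /orP[/eqP->//|xs].
  by apply: sm; rewrite mem_cat inE orbCA xs orbT.
apply: contrapT => nq.
have size_s' : size s' = size s by rewrite !size_cat.
have [|res [t [q [R min_res]]]] := P_correct (w := map e s') (k := 2).
  by rewrite size_map size_s'.
have [L' trL' _] := trace_of_runs R.
move: trL'; rewrite !size_map size_s' => trL'.
rewrite size_map in trL.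
suff E : Some 0 = res.
  move: min_res; rewrite -E => /is_min_edits0; rewrite map_cat /=.
  have fresh x : x \in s -> e x != e z.+1.
    move=> xs; apply/eqP => /letters_inj -/(_ (sm _ xs) zm) xz.
    by have := sev _ xs; have := sev _ zs; lia.
  by apply: single_letter_not_2universal; apply/mapP => -[x xs /esym/eqP];
    apply/negP/fresh; rewrite mem_cat ?inE xs ?orbT.
apply: (trace_agree trL trL') => i j x ijL; have := trace_sound trL ijL.
have mono_s : {in s &, {mono e : x y / (x < y)%O}}.
  by move=> u v /sm um /sm vm; rewrite e_mono.
have mono_s' : {in s' &, {mono e : x y / (x < y)%O}}.
  by move=> u v /s'm um /s'm vm; rewrite e_mono.
rewrite !compare_positions_map // => Ex; rewrite -Ex; apply/esym.
apply: compare_positions_bump; first by apply/allP => y /sev.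
case=> r rp [rz ij]; apply: nq; exists r => //; split=> //.
have x1 : x = 1.
  move: Ex; rewrite /compare_positions /s.
  by case: ij => -[-> ->]; rewrite rz onth_cat_cons_eq ltxx eqxx => -[].
by move: ijL; rewrite x1; case: ij => -[-> ->]; [left|right].
Qed.

(** Doubling reserves the odd numbers for fresh letters. The prefix does not depend on [p]; having
    length [n - m], at least [m], it cycles through all letters. *)
Definition perm_word (p : 'S_m) : seq nat :=
  [seq (i %% m).*2 | i <- iota 0 (n - m)] ++ [seq (p j : nat).*2 | j <- enum 'I_m].

Lemma size_perm_word p : size (perm_word p) = n.
Proof. by rewrite size_cat 2!size_map size_iota size_enum_ord; lia. Qed.

Lemma all_perm_word p :
  all (fun x => ~~ odd x && (x < m.*2)) (perm_word p).
Proof.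
rewrite all_cat; apply/andP; split; apply/allP => _ /mapP[i _ ->];
  rewrite odd_double ltn_double //=.
by rewrite ltn_mod.
Qed.

Lemma onth_perm_word p (j : 'I_m) :
  onth (perm_word p) (n - m + j) = Some (p j : nat).*2.
Proof.
rewrite onth_cat size_map size_iota ltnNge leq_addr /= addKn onthE -map_comp.
by rewrite (nth_map j) ?size_enum_ord // nth_ord_enum.
Qed.

Lemma perm_word_equal p (j : 'I_m) q :
  q != n - m + j -> onth (perm_word p) q = Some (p j : nat).*2 -> q < n - m.
Proof.
move=> qj; case: ltnP => // le_q H.
have qn : q < n by rewrite -(size_perm_word p) -onthTE H.
have qm : q - (n - m) < m by lia.
move: H; rewrite -(subnKC le_q) (onth_perm_word p (Ordinal qm)) => -[E].
have /perm_inj/(congr1 val)/= : p (Ordinal qm) = p j by apply/val_inj/double_inj.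
by move: qj => /[swap] <-; lia.
Qed.

Lemma perm_word_fixed p p' q :
  q < n - m -> onth (perm_word p) q = onth (perm_word p') q.
Proof. by move=> qn; rewrite !onth_cat size_map size_iota qn. Qed.

Lemma perm_word_universal p :
  k_universal 2 (map e (perm_word p)) (map e (perm_word p)).
Proof.
rewrite {2}map_cat.
have letters : {subset map e (perm_word p) <=
    [seq e i.*2 | i <- iota 0 m]}.
  move=> _ /mapP[x /(allP (all_perm_word p))/andP[xev xm] ->].
  by apply/mapP; exists x./2; rewrite ?mem_iota ?even_halfK //=; lia.
apply: cat_2universal => x /letters/mapP[i]; rewrite mem_iota /= => im ->;
  apply: map_f; apply/mapP.
  by exists i; rewrite ?mem_iota ?modn_small //=; lia.
by exists ((p^-1)%g (Ordinal im)); rewrite ?mem_enum // permKV.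
Qed.

(** For each [j], the trace records an equality between the [j]-th letter of the permuted block and
    a position of the fixed prefix. Being valid for both words, it forces [p j = p' j]. *)
Lemma trace_perm_word_inj p p' L :
  trace_on (map e (perm_word p)) (Some 0) L ->
  trace_on (map e (perm_word p')) (Some 0) L -> p = p'.
Proof.
move=> trp trp'; apply/permP => j.
set k := n - m + j; set s := perm_word p.
have kn : k < size s by rewrite size_perm_word /k; have := ltn_ord j; lia.
have Es : s = take k s ++ (p j : nat).*2 :: drop k.+1 s.
  rewrite -{1}(cat_take_drop k s) (drop_nth 0) //.
  by rewrite (onth_nth 0 _ _ _ (onth_perm_word p j)).
have sk : size (take k s) = k by rewrite size_takel // ltnW.
have [|||q qk [qz qL]] := @trace_sees_equal (take k s) (drop k.+1 s) (p j).*2 L.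
- by rewrite -Es all_perm_word.
- by rewrite -Es size_perm_word; lia.
- by rewrite -Es.
rewrite -Es in qz; rewrite sk in qk qL.
have qn := perm_word_equal qk qz.
have mono_e : {in perm_word p' &, {mono e : x y / (x < y)%O}}.
  move=> x y /(allP (all_perm_word p'))/andP[_ xm].
  by move=> /(allP (all_perm_word p'))/andP[_ ym]; rewrite e_mono.
apply/val_inj/double_inj => /=.
case: qL => /(trace_sound trp'); rewrite compare_positions_map //;
  rewrite /compare_positions (onth_perm_word p' j) (perm_word_fixed p' p qn) qz;
  by rewrite ltEnat /=; case: ltngtP.
Qed.

(** With [Q] the length of the longest chosen trace, padding outcome sequences to length [Q] injects
    the permutations into ternary words of length [Q]. *)
Lemma fact_leq_comparisons :
  exists (w : seq U) res t q,
    [/\ size w = n, runs_on b P 2 w res t q & m`! <= 3 ^ q].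
Proof.
have sizew p : size (map e (perm_word p)) = n by rewrite size_map size_perm_word.
have tr_ex (p : 'S_m) : exists L, trace_on (map e (perm_word p)) (Some 0) L /\
    exists t, runs_on b P 2 (map e (perm_word p)) (Some 0) t (size L).
  have [|res [t [q [runs_p min_p]]]] :=
    P_correct (w := map e (perm_word p)) (k := 2).
    by rewrite sizew; lia.
  have E := is_min_edits_universal min_p (@perm_word_universal p).
  rewrite E in runs_p; have [L trL sL] := trace_of_runs runs_p.
  by exists L; split=> //; exists t; rewrite sL.
have [L trL] := choice tr_ex.
case: (@arg_maxnP _ (1%g : 'S_m) xpredT (fun p => size (L p)) isT) => p0 _ max_p0.
have [_ [t0 runs_p0]] := trL p0.
exists (map e (perm_word p0)), (Some 0), t0, (size (L p0)); split=> //.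
set Q := size (L p0) in max_p0 *.
pose answer p i := nth 0 [seq x.2 | x <- L p] i.
have answer_lt3 p i : answer p i < 3.
  rewrite /answer; have [lt_i|ge_i] := ltnP i (size (L p)); last first.
    by rewrite nth_default ?size_map.
  rewrite (nth_map (0, 0, 0)) //.
  case E: (nth _ _ i) => [[k l] x] /=; apply: (@compare_positions_lt3 _ _ _ k l).
  by apply: (trace_sound (proj1 (trL p))); rewrite -E mem_nth.
pose f p : {ffun 'I_Q -> 'I_3} := [ffun i : 'I_Q => inord (answer p i)].
have f_inj : injective f.
  move=> p p' Ef.
  have EL : L p = L p'.
    (* The default value [0] of [nth] in [answer] coincides with the padding. *)
    have padE r : [seq x.2 | x <- L r] ++ nseq (Q - size (L r)) 0 =
        mkseq (answer r) Q.
      apply: (@eq_from_nth _ 0).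
        by rewrite size_cat size_map size_nseq size_mkseq subnKC //; apply: max_p0.
      rewrite size_cat size_map size_nseq subnKC => [i iQ|]; last exact: max_p0.
      rewrite nth_mkseq // nth_cat size_map nth_nseq /answer.
      by case: ltnP => // ?; rewrite if_same nth_default ?size_map.
    have [tr1 _] := trL p; have [tr2 _] := trL p'; rewrite !sizew in tr1 tr2.
    apply: (trace_answers_inj tr1 tr2 (z := nseq (Q - size (L p)) 0)
      (z' := nseq (Q - size (L p')) 0)).
    rewrite !padE; apply: (@eq_from_nth _ 0); rewrite ?size_mkseq // => i iQ.
    rewrite !nth_mkseq //.
    move/ffunP/(_ (Ordinal iQ)): Ef; rewrite !ffunE => /(congr1 val)/=.
    by rewrite !inordK.
  have [tr1 _] := trL p; have [tr2 _] := trL p'; rewrite -EL in tr2.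
  exact: trace_perm_word_inj tr1 tr2.
by have := leq_card f f_inj; rewrite card_Sn card_ffun !card_ord.
Qed.

End HardWords.

(** * Letters from an infinite alphabet and the logarithmic estimate *)

Lemma infinite_monotone_sequence (d : Order.disp_t) (U : orderType d) (N : nat) :
  infinite_set [set: U]%classic ->
  exists e : nat -> U, {in gtn N &, {mono e : x y / x < y >-> (x < y)%O}}.
Proof.
(* Asking for [N.+1] elements provides a default letter [u0] even when [N = 0]. *)
move=> U_infinite; have [B _ sB] := infinite_set_fset N.+1 U_infinite.
set r := sort <=%O (finmap.enum_fset B).
have sr : size r = size (finmap.enum_fset B) by rewrite size_sort.
have [u0 _] : exists u0 : U, True by case: r sr sB => [<-|u0] //; exists u0.
exists (nth u0 r) => x y; rewrite !inE => xN yN; apply: lt_sorted_ltn_nth.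
- by rewrite sort_lt_sorted finmap.fset_uniq.
- by rewrite inE sr; lia.
- by rewrite inE sr; lia.
Qed.

(** The upper [h] factors of the factorial all exceed [h]. *)
Lemma expnn_leq_fact h : h ^ h <= (h.*2)`!.
Proof.
suff H i : h ^ i <= (h + i)`! by rewrite -addnn.
elim: i => [|i IH]; first by rewrite fact_gt0.
by rewrite expnS addnS factS leq_mul // ltnW // ltnS leq_addr.
Qed.

Local Open Scope ring_scope.

Lemma fact_log_bound (R : realType) (n q : nat) : (20 <= n)%N ->
  ((n./2)`! <= 3 ^ q)%N ->
  (8 * (2 * ln 3))^-1 * (n%:R * ln n%:R) <= q%:R :> R.
Proof.
(* From [h ^ h <= 3 ^ q], [n <= 8 * h] and [n <= h ^ 2] one gets
   [n ln n <= 8h * 2 ln h <= 16 q ln 3]. The threshold 20 gives [h >= 5], whence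
   [n <= 4 * h + 3 <= h ^ 2]. *)
move=> n20 le_q; set h := (n %/ 4)%N.
have h5 : (5 <= h)%N by rewrite /h; lia.
have n8h : (n <= 8 * h)%N by rewrite /h; lia.
have nhh : (n <= h ^ 2)%N.
  have n4h : (n < 4 * h + 4)%N by rewrite /h; lia.
  by rewrite -mulnn; move: h5 n4h; clearbody h; nia.
have hq : (h ^ h <= 3 ^ q)%N.
  apply: leq_trans le_q; apply: leq_trans (expnn_leq_fact h) _.
  by apply: leq_fact; rewrite /h; lia.
have ln3 : 0 < ln 3 :> R by rewrite ln_gt0 // ltr1n.
have h0 : 0 < h%:R :> R by rewrite ltr0n; lia.
have n0 : 0 < n%:R :> R by rewrite ltr0n; lia.
have lnn : ln n%:R <= 2 * ln h%:R :> R.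
  rewrite mulr_natl -lnXn // ler_ln ?posrE ?exprn_gt0 //.
  by rewrite -natrX ler_nat.
have lnh : h%:R * ln h%:R <= q%:R * ln 3 :> R.
  rewrite !mulr_natl -!lnXn // ler_ln ?posrE ?exprn_gt0 //.
  by rewrite -!natrX ler_nat.
rewrite mulrC ler_pdivrMr; last by rewrite !mulr_gt0.
have nR : n%:R <= 8 * h%:R :> R by rewrite -natrM ler_nat.
have lnn0 : 0 <= ln n%:R :> R by rewrite ln_ge0 // ler1n; lia.
apply: (le_trans (ler_pM _ lnn0 nR lnn)); first exact: ltW.
nra.
Qed.

Theorem theorem8 (R : realType) (d : Order.disp_t) (U : orderType d)
  (U_infinite : infinite_set [set: U]%classic)
  (op : edit_op) (b : nat -> nat) (P : program)
  (b_valid : valid_word_size b)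
  (P_correct : computes_min_edits U op b P) :
  worst_case_Omega (@uses_comparisons d U b P)
    (fun n : nat => n%:R * ln (n%:R : R))%R /\
  worst_case_Omega (@uses_time d U b P)
    (fun n : nat => n%:R * ln (n%:R : R))%R.
Proof.
have c_gt0 : 0 < (8 * (2 * ln 3))^-1 :> R.
  by rewrite invr_gt0 !mulr_gt0 // ln_gt0 // ltr1n.
have hard n : (20 <= n)%N -> exists (w : seq U) res t q,
    [/\ size w = n, runs_on b P 2 w res t q &
    (8 * (2 * ln 3))^-1 * (n%:R * ln n%:R) <= q%:R :> R].
  move=> n20; have [e e_mono] := infinite_monotone_sequence n./2.*2 U_infinite.
  have [||w [res [t [q [sw Hw Hq]]]]] :=
    fact_leq_comparisons P_correct (m := n./2) (n := n) e_mono; [lia..|].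
  by exists w, res, t, q; split=> //; apply: fact_log_bound.
split; exists (8 * (2 * ln 3))^-1 => //; exists 20%N => n n20;
  have [w [res [t [q [sw Hw Hq]]]]] := hard n n20.
  by exists w, 2%N, q; split=> //; [lia|exists res, t].
(* Every comparison is a step, so the same input witnesses the time bound. *)
exists w, 2%N, t; split=> //; [lia|by exists res, q|].
by apply: (le_trans Hq); rewrite ler_nat; apply: runs_leq Hw.
Qed.
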